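(* Let $\alpha,\gamma$ be umbrae and $x\in\mathbf{x}$ a variable. A polynomial sequence $(s_n(x))_{n\ge0}$ is the Sheffer sequence of $(\gamma,\alpha)$ if and only if, for all $n\ge1$, \[ s_n(x)\simeq(x+\mathcal{K}_{\gamma,\alpha})\bigl(x+\mathcal{K}_{\gamma,\alpha}+n\boldsymbol{\cdot}\mathcal{K}_\alpha\bigr)^{n-1}. \]
   Context: Umbral calculus setting. Fix a finite set $\mathbf{x}$ of commuting variables and a further variable $z$. To every formal power series $f(z)\in\mathbb{C}[\mathbf{x}][[z]]$ with $f(0)=1$ a symbol (its umbra) is attached. The evaluation $E$ is the $\mathbb{C}[\mathbf{x}]$-linear functional on polynomials in umbrae with coefficients in $\mathbb{C}[\mathbf{x}]$ such that $E[\alpha^n]=n![z^n]f(z)$ when $\alpha$ is the umbra of $f$, and $E[\alpha^n\gamma^m\cdots\delta^l]=E[\alpha^n]E[\gamma^m]\cdots E[\delta^l]$ for pairwise distinct umbrae; elements of $\mathbb{C}[\mathbf{x}]$ (such as $x$) are constants for $E$. Write $\mathbf p\simeq\mathbf q$ if $E[\mathbf p]=E[\mathbf q]$. For an umbral polynomial $\mathbf p$ let $f_{\mathbf p}(z)=E[e^{\mathbf p z}]$. Auxiliary umbrae (treated as further umbrae, uncorrelated with all other distinct umbrae): the dot-product umbra $\mathbf p\boldsymbol{\cdot}\mathbf q$ has $f_{\mathbf p\boldsymbol{\cdot}\mathbf q}(z)=f_{\mathbf p}(\log f_{\mathbf q}(z))$; for a scalar $a$, $f_{a\boldsymbol{\cdot}\alpha}(z)=f_\alpha(z)^a$;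 for a positive integer $n$, $n\boldsymbol{\cdot}\alpha$ behaves as a sum of $n$ distinct umbrae similar to $\alpha$; $\gamma-n\boldsymbol{\cdot}\alpha$ means $\gamma+(-n\boldsymbol{\cdot}\alpha)$. The Bell umbra $\beta$ is the umbra of $e^{e^z-1}$. The derivative umbra $\alpha_D$ satisfies $f_{\alpha_D}(z)=1+zf_\alpha(z)$. For umbrae $\gamma,\alpha$, $\mathcal{K}_{\gamma,\alpha}$ denotes an umbra with $E[\mathcal{K}_{\gamma,\alpha}^n]=E[\gamma(\gamma-n\boldsymbol{\cdot}\alpha)^{n-1}]$ for all $n\ge1$, and $\mathcal{K}_\alpha=\mathcal{K}_{\alpha,\alpha}$; distinct such symbols are uncorrelated. The Sheffer sequence of $(\gamma,\alpha)$ is the polynomial sequence $s_n(x)=E[(\gamma+x\boldsymbol{\cdot}\beta\boldsymbol{\cdot}\alpha_D)^n]$, i.e. $\sum_{n\ge0}s_n(x)z^n/n!=f_\gamma(z)\,e^{xzf_\alpha(z)}$.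
   Formalization: The polynomial sequence is additionally assumed to satisfy s_0(x) = 1, since the condition for n ≥ 1 says nothing about s_0 and the converse would otherwise fail. *)

(* Defs.v *)
From HB Require Import structures.
From mathcomp Require Import all_boot all_order all_algebra.
From mathcomp Require Import finmap boolp reals complex.
From mathcomp Require Import monalg.

Set Implicit Arguments.
Unset Strict Implicit.
Unset Printing Implicit Defensive.

Import GRing.Theory.
Local Open Scope ring_scope.

(* Everything is set up over a commutative algebra A over a field C; the case  *)
(* of interest is A = {mpoly C[k]} with C the field of complex numbers.        *)
(* C is meant to have characteristic 0, as factorials are inverted.            *)

(* Formal power series in z over A are given by their coefficients in A^nat.   *)
Section PowerSeries.
Context {C : fieldType} {A : comAlgType C}.
Implicit Types (f g : nat -> A) (a : A).

Definition fps_one (n : nat) : A := (n == 0)%:R.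

Definition fps_mul f g (n : nat) : A := \sum_(i < n.+1) f i * g (n - i)%N.

Definition fps_exp f (k : nat) : nat -> A := iter k (fps_mul f) fps_one.

(* f(g(z)); only meaningful when g 0 = 0, so that g^k has no term below z^k.   *)
Definition fps_comp f g (n : nat) : A := \sum_(k < n.+1) f k * fps_exp g k n.

Definition fps_sub1 f (n : nat) : A := f n - fps_one n.

(* e^{az} *)
Definition exp_series a (n : nat) : A := n`!%:R^-1 *: a ^+ n.

(* log(1 + z); the coefficient at n = 0 is 0 since 0^-1 = 0. *)
Definition log1p_series (n : nat) : A := ((-1) ^+ n.+1 / n%:R)%:A.

(* log f(z), for f 0 = 1 *)
Definition fps_log f : nat -> A := fps_comp log1p_series (fps_sub1 f).

(* f(z)^a = e^{a log f(z)}, for f 0 = 1 *)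
Definition fps_pow f a : nat -> A := fps_comp (exp_series a) (fps_log f).

End PowerSeries.

Section Umbrae.
Context {C : fieldType} (A : comAlgType C).

(* The umbra attached to f(z) with f(0) = 1: one symbol for each such series.  *)
Record umbra := Umbra { umbra_series : nat -> A ; _ : umbra_series 0%N == 1 }.

(* All umbral symbols: the umbrae above and the auxiliary umbrae.  Distinct    *)
(* terms of this type are distinct, hence uncorrelated, symbols.               *)
(* - ScalDot a u is a.u for a scalar a, and Dot u v is u.v;                    *)
(* - AbelSym g a f is a symbol with name (g, a) and series f; it is only used  *)
(*   through abel_umbra below, where f is determined by g and a.               *)
Inductive symbol :=
  | Prim of umbra
  | AbelSym of symbol & symbol & umbra
  | ScalDot of A & symbol
  | Dot of symbol & symbol
  | Deriv of symbol.

HB.instance Definition _ := gen_eqMixin symbol.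
HB.instance Definition _ := gen_choiceMixin symbol.

Fixpoint series_of (u : symbol) : nat -> A :=
  match u with
  | Prim f => umbra_series f
  | AbelSym _ _ f => umbra_series f
  | ScalDot a v => fps_pow (series_of v) a
  | Dot v w => fps_comp (series_of v) (fps_log (series_of w))
  | Deriv v => fun n => if n is m.+1 then series_of v m else 1
  end.

(* Umbral polynomials: the free commutative A-algebra on the symbols.          *)
Local Notation upoly := {malg A[{cmonom symbol}]}.

Definition uconst (c : A) : upoly := c%:A.

Definition um (u : symbol) : upoly := << ucm u >>.

Definition moment (u : symbol) (n : nat) : A := series_of u n *+ n`!.

(* A-linear, and multiplicative over distinct symbols.                         *)
Definition E (p : upoly) : A :=
  \sum_(m <- msupp p)
     mcoeff m p * \prod_(u <- finsupp m) moment u (m u).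

Definition umbral_equiv (p q : upoly) : Prop := E p = E q.

Definition bell_series : nat -> A :=
  fps_comp (exp_series 1) (fps_sub1 (exp_series 1)).

Fact bell_series0 : bell_series 0%N == 1.
Proof.
rewrite /bell_series /fps_comp big_ord1 /exp_series fact0 expr0 invr1 scale1r.
by rewrite mul1r /fps_exp /= /fps_one eqxx.
Qed.

Definition bell_umbra : symbol := Prim (Umbra bell_series0).

(* The series whose n-th moment is E[g (g - n.a)^(n-1)] for n >= 1.            *)
Definition abel_series (g a : symbol) (n : nat) : A :=
  if n is m.+1 then
    n`!%:R^-1 *: E (um g * (um g + um (ScalDot (- n%:R) a)) ^+ m)
  else 1.

Definition abel_umbra (g a : symbol) : symbol :=
  @AbelSym g a (@Umbra (abel_series g a) (eqxx 1)).

Definition sheffer (g a : symbol) (x : A) (n : nat) : A :=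
  E ((um g + um (ScalDot x (Dot bell_umbra (Deriv a)))) ^+ n).

Definition is_sheffer_sequence (g a : symbol) (x : A) (s : nat -> A) : Prop :=
  forall n : nat, s n = sheffer g a x n.

End Umbrae.

Coercion Prim : umbra >-> symbol.

(* Main.v *)
From HB Require Import structures.
Require Import Defs.
From mathcomp Require Import all_boot all_order all_algebra.
From mathcomp Require Import finmap boolp functions reals complex ring.
From mathcomp Require Import monalg mpoly.
Set Implicit Arguments.
Unset Strict Implicit.
Unset Printing Implicit Defensive.
Import GRing.Theory Num.Theory.
Local Open Scope ring_scope.

(* Put [g = z f_alpha] and [b = 1 / f_alpha].  The moments of [K_{gamma,alpha}]
   are [n! [z^n] f_K = (n-1)! [z^(n-1)] f_gamma' b^n], so Lagrange inversion
   gives [f_{K_{gamma,alpha}} o g = f_gamma], and likewise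
   [f_{K_alpha} o g = f_alpha].  With [G = e^(xz) f_{K_{gamma,alpha}}] the
   Sheffer generating series [f_gamma e^(xg)] is therefore [G o g], while the
   right-hand side is [(n-1)! [z^(n-1)] G' f_{K_alpha}^n]; the invariance of
   the residue under substitution of [g] turns the latter into
   [n! [z^n] (G o g)]. *)

(** * Multiples by factorials *)

Lemma mulrn_fact_bin (B : nzRingType) (a b : B) n i : (i <= n)%N ->
  (a *+ i`!) * (b *+ (n - i)`!) *+ 'C(n, i) = a * b *+ n`!.
Proof.
move=> le_in; rewrite -(bin_fact le_in) mulrnAl mulrnAr -!mulrnA.
by congr (_ *+ _); ring.
Qed.

Section Char0Modules.
Context {C : fieldType} {V : lmodType C}.
Hypothesis charC0 : has_pchar0 C.

Lemma mulrSn_inj n : injective (fun a : V => a *+ n.+1).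
Proof.
have Sn_neq0 : n.+1%:R != 0 :> C by rewrite (pcharf0P C).1.
move=> a b /(congr1 ( *:%R n.+1%:R^-1)).
by rewrite -!scaler_nat !scalerA mulVf // !scale1r.
Qed.

Lemma mulrn_fact_inj n : injective (fun a : V => a *+ n`!).
Proof. by rewrite -(prednK (fact_gt0 n)); apply: mulrSn_inj. Qed.

Lemma scale_invfactK n : cancel ( *:%R n`!%:R^-1) (fun a : V => a *+ n`!).
Proof.
have fact_neq0 : n`!%:R != 0 :> C by rewrite (pcharf0P C).1 // -lt0n fact_gt0.
by move=> a; rewrite -scaler_nat scalerA divff // scale1r.
Qed.

End Char0Modules.

(** * The ring of formal power series *)

Definition fps (C : fieldType) (A : comAlgType C) : Type := nat -> A.

Section FpsRing.
Context {C : fieldType} {A : comAlgType C}.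
Implicit Types (f g h : fps A) (p q : {poly A}).

HB.instance Definition _ := GRing.Zmodule.copy (fps A) (nat -> A).

Definition fps_trunc N f : {poly A} := \poly_(i < N) f i.

Lemma fps_mul_coef p q f g n :
    (forall i, (i <= n)%N -> p`_i = f i) ->
    (forall i, (i <= n)%N -> q`_i = g i) ->
  fps_mul f g n = (p * q)`_n.
Proof.
move=> pf qg; rewrite coefM; apply: eq_bigr => i _.
by rewrite pf ?qg ?leq_subr // -ltnS.
Qed.

Lemma fps_mul_trunc N f g n : (n < N)%N ->
  fps_mul f g n = (fps_trunc N f * fps_trunc N g)`_n.
Proof.
move=> lt_nN; apply: fps_mul_coef => i le_in;
  by rewrite coef_poly (leq_ltn_trans le_in).
Qed.

Fact fps_mulC : commutative (@fps_mul C A).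
Proof.
by move=> f g; apply/funext => n; rewrite !(@fps_mul_trunc n.+1) // mulrC.
Qed.

Fact fps_mulA : associative (@fps_mul C A).
Proof.
have mul3_trunc f g h n : fps_mul f (fps_mul g h) n =
    (fps_trunc n.+1 f * (fps_trunc n.+1 g * fps_trunc n.+1 h))`_n.
  apply: fps_mul_coef => i le_in; first by rewrite coef_poly ltnS le_in.
  by rewrite -fps_mul_trunc.
move=> f g h; apply/funext => n.
by rewrite [fps_mul (fps_mul _ _) _]fps_mulC !mul3_trunc mulrA mulrC.
Qed.

Fact fps_mul1 : left_id (@fps_one C A) (@fps_mul C A).
Proof.
move=> f; apply/funext => n; rewrite /fps_mul big_ord_recl big1 ?subn0.
  by rewrite addr0 mul1r.
by move=> i _; rewrite mul0r.
Qed.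

Fact fps_mulD : left_distributive (@fps_mul C A) (fun f g => f + g : fps A).
Proof.
move=> f g h; apply/funext => n; rewrite -[RHS]big_split /=.
by apply: eq_bigr => i _; rewrite mulrDl.
Qed.

Fact fps_one_neq0 : (@fps_one C A : fps A) != 0.
Proof.
by apply/eqP => /(congr1 (@^~ 0%N))/eqP; rewrite /fps_one /= oner_eq0.
Qed.

HB.instance Definition _ := GRing.Zmodule_isComNzRing.Build (fps A)
  fps_mulA fps_mulC fps_mul1 fps_mulD fps_one_neq0.

Lemma fpsD f g n : (f + g) n = f n + g n. Proof. by []. Qed.

Lemma fpsB f g n : (f - g) n = f n - g n. Proof. by []. Qed.

Lemma fpsMn f m n : (f *+ m) n = f n *+ m.
Proof. exact: (congr1 (@^~ n) (natmulfctE f m)). Qed.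

Lemma fps_sumE (I : Type) (r : seq I) (P : pred I) (F : I -> fps A) n :
  (\sum_(i <- r | P i) F i) n = \sum_(i <- r | P i) F i n.
Proof. exact: (congr1 (@^~ n) (fct_sumE r P F)). Qed.

Lemma fpsM f g n : (f * g) n = \sum_(i < n.+1) f i * g (n - i)%N.
Proof. by []. Qed.

Lemma fps_expE f k : fps_exp f k = f ^+ k.
Proof. by elim: k => //= k IHk; rewrite exprS -IHk. Qed.

Lemma fpsM_coef0 f g : (f * g) 0%N = f 0%N * g 0%N.
Proof. by rewrite fpsM big_ord1. Qed.

Lemma fpsXn_coef0 f k : (f ^+ k) 0%N = f 0%N ^+ k.
Proof. by elim: k => // k IHk; rewrite !exprS fpsM_coef0 IHk. Qed.

Lemma eq_fpsM_le f f' g g' n :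
    (forall i, (i <= n)%N -> f i = f' i) ->
    (forall i, (i <= n)%N -> g i = g' i) ->
  (f * g) n = (f' * g') n.
Proof.
move=> ff' gg'; apply: eq_bigr => i _.
by rewrite ff' 1?gg' ?leq_subr // -ltnS.
Qed.

Lemma eq_fpsM_lt g f f' n : g 0%N = 0 ->
  (forall i, (i < n)%N -> f i = f' i) -> (g * f) n = (g * f') n.
Proof.
move=> g0; case: n => [|n] ff'; first by rewrite !fpsM_coef0 g0 !mul0r.
rewrite !fpsM big_ord_recl [RHS]big_ord_recl g0 !mul0r; congr (_ + _).
apply: eq_bigr => i _.
by rewrite lift0 subSS ff' // ltnS leq_subr.
Qed.

Lemma fpsXn_coef_small g k n : g 0%N = 0 -> (n < k)%N -> (g ^+ k) n = 0.
Proof.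
move=> g0; elim: k n => // k IHk n; rewrite ltnS => le_nk.
rewrite exprS (@eq_fpsM_lt _ _ 0) ?mulr0 // => i lt_in.
exact: IHk (leq_trans lt_in le_nk).
Qed.

End FpsRing.

Section FpsGenerators.
Context {C : fieldType} {A : comAlgType C}.
Implicit Types (f : fps A) (c : A).

Definition fpsC c : fps A := fun n => if n is 0 then c else 0.
Definition fpsX : fps A := fun n => (n == 1%N)%:R.
Definition fps_shift f : fps A := fun n => f n.+1.

Lemma fpsCM c f n : (fpsC c * f) n = c * f n.
Proof.
rewrite fpsM big_ord_recl big1 ?subn0 ?addr0 // => i _.
by rewrite mul0r.
Qed.

Fact fpsC_is_zmod_morphism : zmod_morphism fpsC.
Proof. by move=> c d; apply/funext => -[|n]; rewrite fpsB //= subrr. Qed.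

Fact fpsC_is_monoid_morphism : monoid_morphism fpsC.
Proof.
split=> [|c d]; apply/funext => -[|n] //; rewrite fpsCM //.
by rewrite mulr0.
Qed.

HB.instance Definition _ :=
  GRing.isZmodMorphism.Build A (fps A) fpsC fpsC_is_zmod_morphism.
HB.instance Definition _ :=
  GRing.isMonoidMorphism.Build A (fps A) fpsC fpsC_is_monoid_morphism.

Lemma fpsXM_coef0 f : (fpsX * f) 0%N = 0.
Proof. by rewrite fpsM_coef0 mul0r. Qed.

Lemma fpsXM_coefS f n : (fpsX * f) n.+1 = f n.
Proof.
rewrite fpsM big_ord_recl mul0r add0r big_ord_recl subn1 mul1r big1 ?addr0 //.
by move=> i _; rewrite mul0r.
Qed.

Lemma fps_shiftXM f : fps_shift (fpsX * f) = f.
Proof. by apply/funext => n; rewrite /fps_shift fpsXM_coefS. Qed.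

Lemma fps_split f : f = fpsC (f 0%N) + fpsX * fps_shift f.
Proof.
apply/funext => -[|n]; rewrite fpsD ?fpsXM_coef0 ?fpsXM_coefS /= ?addr0 //.
by rewrite add0r.
Qed.

End FpsGenerators.

(** * Composition *)

Local Notation "f \oF g" := (fps_comp f g : fps _)
  (at level 39, left associativity, format "f  \oF  g") : ring_scope.

Section FpsComposition.
Context {C : fieldType} {A : comAlgType C}.
Implicit Types (f g h : fps A) (c : A).

Lemma fps_comp_coef0 f g : (f \oF g) 0%N = f 0%N.
Proof. by rewrite /fps_comp big_ord1; apply: mulr1. Qed.

Lemma fps_compD f h g : (f + h) \oF g = f \oF g + h \oF g.
Proof.
apply/funext => n; rewrite fpsD -big_split; apply: eq_bigr => i _.
by rewrite fpsD mulrDl.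
Qed.

Lemma fps_compCM c f g : (fpsC c * f) \oF g = fpsC c * (f \oF g).
Proof.
apply/funext => n; rewrite fpsCM mulr_sumr; apply: eq_bigr => i _.
by rewrite fpsCM mulrA.
Qed.

Lemma fps_comp1 g : (1 : fps A) \oF g = 1.
Proof.
apply/funext => n; rewrite /fps_comp big_ord_recl big1 ?addr0 ?mul1r //.
by move=> i _; rewrite mul0r.
Qed.

Lemma fps_compC c g : fpsC c \oF g = fpsC c.
Proof. by rewrite -[fpsC c]mulr1 fps_compCM fps_comp1. Qed.

Lemma fps_comp_widen f g n N : g 0%N = 0 -> (n < N)%N ->
  (f \oF g) n = (\sum_(k < N) fpsC (f k) * g ^+ k) n.
Proof.
move=> g0 lt_nN; rewrite fps_sumE /fps_comp.
rewrite (big_ord_widen N (fun k => f k * fps_exp g k n) lt_nN).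
rewrite [RHS](bigID (fun i : 'I_N => (i < n.+1)%N)) /=.
rewrite [X in _ = _ + X]big1 ?addr0 => [|i].
  by apply: eq_bigr => i _; rewrite fpsCM fps_expE.
by rewrite -leqNgt => lt_ni; rewrite fpsCM fpsXn_coef_small ?mulr0.
Qed.

(* Horner's rule; it makes the coefficients of [f \oF g] computable by strong
   induction on the index, as [g] has no constant term. *)
Lemma fps_comp_split f g : g 0%N = 0 ->
  f \oF g = fpsC (f 0%N) + g * (fps_shift f \oF g).
Proof.
move=> g0; apply/funext => n.
rewrite (@fps_comp_widen _ _ _ n.+2) // big_ord_recl mulr1 !fpsD; congr (_ + _).
pose S := \sum_(k < n.+1) fpsC (f k.+1) * g ^+ k.
rewrite [RHS](@eq_fpsM_le _ _ _ g _ S) //.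
  rewrite mulr_sumr !fps_sumE; apply: eq_bigr => i _.
  by rewrite exprS mulrCA.
by move=> i; rewrite -ltnS => lt_in; apply: fps_comp_widen.
Qed.

Lemma fps_compXM f g : g 0%N = 0 -> (fpsX * f) \oF g = g * (f \oF g).
Proof.
by move=> g0; rewrite fps_comp_split // fpsXM_coef0 fps_shiftXM raddf0 add0r.
Qed.

Lemma fps_compX g : g 0%N = 0 -> fpsX \oF g = g.
Proof. by move=> g0; rewrite -[fpsX]mulr1 fps_compXM // fps_comp1 mulr1. Qed.

Lemma fps_compM f h g : g 0%N = 0 -> (f * h) \oF g = (f \oF g) * (h \oF g).
Proof.
move=> g0; apply/funext => n; elim/ltn_ind: n f => n IHn f.
rewrite [in LHS](fps_split f) mulrDl -mulrA fps_compD fps_compCM fps_compXM //.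
rewrite (fps_comp_split f) // mulrDl -mulrA !fpsD; congr (_ + _).
by apply: eq_fpsM_lt => // i /IHn ->.
Qed.

Lemma fps_compXn f g k : g 0%N = 0 -> (f ^+ k) \oF g = (f \oF g) ^+ k.
Proof.
move=> g0; elim: k => [|k IHk]; first by rewrite fps_comp1.
by rewrite exprS fps_compM // IHk exprS.
Qed.

Lemma fps_compA f g h : g 0%N = 0 -> h 0%N = 0 ->
  f \oF (g \oF h) = (f \oF g) \oF h.
Proof.
move=> g0 h0; have gh0 : (g \oF h) 0%N = 0 by rewrite fps_comp_coef0.
apply/funext => n; elim/ltn_ind: n f => n IHn f.
rewrite (fps_comp_split f) // (fps_comp_split f g0).
rewrite fps_compD fps_compC fps_compM // !fpsD; congr (_ + _).
by apply: eq_fpsM_lt => // i /IHn ->.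
Qed.

Lemma fps_sub1E f : fps_sub1 f = f - 1. Proof. by []. Qed.

Lemma fps_sub1_coef0 f : f 0%N = 1 -> fps_sub1 f 0%N = 0.
Proof. by rewrite /fps_sub1 => ->; rewrite subrr. Qed.

Lemma fps_comp_sub1 f g : fps_sub1 f \oF g = fps_sub1 (f \oF g).
Proof.
rewrite !fps_sub1E; apply/eqP; rewrite eq_sym subr_eq -{2}(fps_comp1 g).
by rewrite -fps_compD subrK.
Qed.

End FpsComposition.

(** * Derivation *)

Section FpsDerivation.
Context {C : fieldType} {A : comAlgType C}.
Implicit Types (f g : fps A) (c : A).

Definition fps_deriv f : fps A := fun n => f n.+1 *+ n.+1.

Fact fps_deriv_is_zmod_morphism : zmod_morphism fps_deriv.
Proof. by move=> f g; apply/funext => n; rewrite /fps_deriv !fpsB mulrnBl. Qed.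

HB.instance Definition _ := GRing.isZmodMorphism.Build (fps A) (fps A) fps_deriv
  fps_deriv_is_zmod_morphism.

Lemma fps_derivC c : fps_deriv (fpsC c) = 0.
Proof. by apply/funext => n; rewrite /fps_deriv mul0rn. Qed.

Lemma fps_deriv1 : fps_deriv 1 = 0.
Proof. by rewrite -(rmorph1 fpsC) fps_derivC. Qed.

Lemma fps_derivX : fps_deriv fpsX = 1.
Proof. by apply/funext => -[|n] //; rewrite /fps_deriv mul0rn. Qed.

Lemma fps_derivM f g : fps_deriv (f * g) = fps_deriv f * g + f * fps_deriv g.
Proof.
have coef_trunc (h : fps A) i n : (i <= n.+1)%N -> (fps_trunc n.+2 h)`_i = h i.
  by rewrite coef_poly ltnS => ->.
apply/funext => n.
rewrite /fps_deriv [(f * g) _](fps_mul_trunc _ _ (leqnn n.+2)).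
rewrite -coef_deriv derivM coefD; congr (_ + _);
  by apply/esym/fps_mul_coef => i le_in; rewrite ?coef_deriv coef_trunc // leqW.
Qed.

Lemma fps_derivXn f k :
  fps_deriv (f ^+ k.+1) = f ^+ k * fps_deriv f *+ k.+1.
Proof.
elim: k => [|k IHk]; first by rewrite mul1r.
rewrite exprS fps_derivM IHk mulrnAr mulrA -exprS.
by rewrite [fps_deriv f * _]mulrC -mulrS.
Qed.

Lemma fps_deriv_comp f g : g 0%N = 0 ->
  fps_deriv (f \oF g) = (fps_deriv f \oF g) * fps_deriv g.
Proof.
move=> g0; apply/funext => n; elim/ltn_ind: n f => n IHn f.
rewrite [in RHS](fps_split f) (fps_comp_split f) // !raddfD /= !fps_derivC.
rewrite !add0r !fps_derivM fps_derivX mul1r fps_compD fps_compXM // mulrDl.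
rewrite -mulrA mulrC !fpsD; congr (_ + _).
by apply: eq_fpsM_lt => // i /IHn ->.
Qed.

Lemma fps_deriv_inv f g : f * g = 1 -> fps_deriv f * g ^+ 2 = - fps_deriv g.
Proof.
move=> fg1; have /eqP := fps_derivM f g.
rewrite fg1 fps_deriv1 eq_sym addr_eq0 => /eqP f'g.
by rewrite expr2 mulrA f'g mulNr mulrAC fg1 mul1r.
Qed.

Hypothesis charC0 : has_pchar0 C.

Lemma fps_deriv_inj f g : f 0%N = g 0%N -> fps_deriv f = fps_deriv g -> f = g.
Proof.
move=> fg0 f'g'; apply/funext => -[//|n].
exact: (mulrSn_inj charC0 (congr1 (@^~ n) f'g')).
Qed.

End FpsDerivation.

(** * Exponential, logarithm and powers *)

Section ExpLogPow.
Context {C : fieldType} {A : comAlgType C}.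
Hypothesis charC0 : has_pchar0 C.
Implicit Types (f h : fps A) (a b : A).
Local Notation fexp a := (exp_series a : fps A).
Local Notation flog f := (fps_log f : fps A).
Local Notation fpow f a := (fps_pow f a : fps A).

Lemma exp_series_fact a n : exp_series a n *+ n`! = a ^+ n.
Proof. exact: scale_invfactK. Qed.

Lemma exp_series_coef0 a : exp_series a 0%N = 1.
Proof. exact: (exp_series_fact a 0). Qed.

Lemma exp_seriesD a b : fexp (a + b) = fexp a * fexp b.
Proof.
apply/funext => n; apply: (mulrn_fact_inj charC0 (n := n)).
rewrite exp_series_fact addrC exprDn fpsM -sumrMnl; apply: eq_bigr => i _.
rewrite -(mulrn_fact_bin _ _ (ltn_ord i : (i <= n)%N)) !exp_series_fact.
by rewrite mulrC.
Qed.

Lemma exp_series0 : fexp 0 = 1.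
Proof.
apply/funext => n; apply: (mulrn_fact_inj charC0 (n := n)).
by rewrite exp_series_fact expr0n; case: n => [|n]; rewrite ?mul0rn.
Qed.

Lemma fps_deriv_exp a : fps_deriv (exp_series a) = fpsC a * fexp a.
Proof.
apply/funext => n; apply: (mulrn_fact_inj charC0 (n := n)).
rewrite /fps_deriv -mulrnA -factS exp_series_fact fpsCM -mulrnAr.
by rewrite exp_series_fact exprS.
Qed.

Lemma fps_deriv_log1p : (1 + fpsX) * fps_deriv log1p_series = 1 :> fps A.
Proof.
have log1p' n : fps_deriv (@log1p_series C A) n = (-1) ^+ n.
  rewrite /fps_deriv /log1p_series -scaler_nat scalerA mulrC -mulrA.
  rewrite mulVf ?(pcharf0P C).1 // mulr1 !exprS !mulN1r opprK -in_algE.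
  exact: rmorph_sign.
apply/funext => -[|n]; rewrite mulrDl mul1r fpsD log1p'.
  by rewrite fpsXM_coef0 addr0.
by rewrite fpsXM_coefS log1p' exprS mulN1r addNr.
Qed.

Lemma fps_log_coef0 f : fps_log f 0%N = 0.
Proof.
by rewrite /fps_log fps_comp_coef0 /log1p_series invr0 mulr0 scale0r.
Qed.

Lemma fps_deriv_log f : f 0%N = 1 -> fps_deriv (fps_log f) * f = fps_deriv f.
Proof.
move=> f0; pose h : fps A := fps_sub1 f.
have h0 : h 0%N = 0 := fps_sub1_coef0 f0.
have h' : fps_deriv h = fps_deriv f.
  by rewrite [h]fps_sub1E raddfB /= fps_deriv1 subr0.
have f_log1p' : f * (fps_deriv log1p_series \oF h) = 1.
  rewrite -[RHS](fps_comp1 h) -fps_deriv_log1p fps_compM // fps_compD.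
  by rewrite fps_comp1 fps_compX // [h]fps_sub1E subrKC.
by rewrite fps_deriv_comp // h' mulrC mulrA f_log1p' mul1r.
Qed.

Lemma fps_powD f a b : fpow f (a + b) = fpow f a * fpow f b.
Proof. by rewrite /fps_pow exp_seriesD fps_compM // fps_log_coef0. Qed.

Lemma fps_powr0 f : fpow f 0 = 1.
Proof. by rewrite /fps_pow exp_series0 fps_comp1. Qed.

Lemma fps_powMn f a n : fpow f (a *+ n) = fpow f a ^+ n.
Proof.
elim: n => [|n IHn]; first exact: fps_powr0.
by rewrite mulrS fps_powD IHn exprS.
Qed.

Lemma fps_pow_coef0 f a : fps_pow f a 0%N = 1.
Proof. by rewrite /fps_pow fps_comp_coef0 exp_series_coef0. Qed.

(* [f e^(- log f)] has zero derivative. *)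
Lemma fps_mul_powN1 f : f 0%N = 1 -> f * fpow f (-1) = 1.
Proof.
move=> f0; apply: (fps_deriv_inj charC0).
  by rewrite fpsM_coef0 f0 fps_pow_coef0 mulr1.
rewrite fps_derivM [fps_deriv (fps_pow _ _)]fps_deriv_comp ?fps_log_coef0 //.
rewrite fps_deriv_exp fps_compCM rmorphN1 fps_deriv1 -(fps_deriv_log f0).
rewrite -/(fps_pow f (-1)).
by ring.
Qed.

Lemma fps_powr1 f : f 0%N = 1 -> fpow f 1 = f.
Proof.
move=> f0; rewrite -[RHS]mulr1 -(fps_powr0 f) -(addNr 1) fps_powD mulrA.
by rewrite fps_mul_powN1 // mul1r.
Qed.

Lemma fps_pow_nat f n : f 0%N = 1 -> fpow f n%:R = f ^+ n.
Proof. by move=> f0; rewrite fps_powMn fps_powr1. Qed.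

Lemma fps_log_exp h : h 0%N = 0 -> flog (fexp 1 \oF h) = h.
Proof.
move=> h0; set f := fexp 1 \oF h.
have f0 : f 0%N = 1 by rewrite /f fps_comp_coef0 exp_series_coef0.
apply: (fps_deriv_inj charC0); first by rewrite fps_log_coef0 h0.
have f' : fps_deriv f = fps_deriv h * f.
  by rewrite fps_deriv_comp // fps_deriv_exp rmorph1 mul1r mulrC.
rewrite -[LHS]mulr1 -(fps_mul_powN1 f0) mulrA fps_deriv_log // f' -mulrA.
by rewrite fps_mul_powN1 // mulr1.
Qed.

(* Bell's series is [e^(e^z - 1)], so its composite with [log f] is
   [e^(f - 1)]. *)
Lemma fps_pow_bell_log f a : f 0%N = 1 ->
  fpow (bell_series A \oF fps_log f) a = fexp a \oF fps_sub1 f.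
Proof.
move=> f0; have e0 := fps_sub1_coef0 (exp_series_coef0 1).
rewrite /bell_series -fps_compA ?fps_log_coef0 // fps_comp_sub1.
rewrite -/(fps_pow f 1) fps_powr1 // /fps_pow fps_log_exp //.
exact: fps_sub1_coef0.
Qed.

End ExpLogPow.

(** * Lagrange inversion *)

Section Lagrange.
Context {C : fieldType} {A : comAlgType C}.
Hypothesis charC0 : has_pchar0 C.
Variables a b : fps A.
Hypothesis ab1 : a * b = 1.
Implicit Types f k G M : fps A.
Local Notation g := (fpsX * a).

(* As [b = z / g], the coefficient [(M * b ^+ n.+1) n] is the formal residue
   of [M / g^(n+1)]. *)
Lemma fps_residue_deriv n : (fps_deriv g * b ^+ n.+1) n = (n == 0)%:R.
Proof.
rewrite fps_derivM fps_derivX mul1r mulrDl exprS mulrA ab1 mul1r -mulrA fpsD.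
case: n => [|n]; first by rewrite fpsXM_coef0 addr0.
rewrite fpsXM_coefS exprS [b * (b * _)]mulrA -expr2 mulrA fps_deriv_inv //.
rewrite mulNr; apply/eqP; rewrite subr_eq0; apply/eqP.
apply: (mulrSn_inj charC0 (n := n)).
by rewrite -exprS mulrC -[RHS]fpsMn -fps_derivXn.
Qed.

Lemma fps_residue_comp M n : ((M \oF g) * fps_deriv g * b ^+ n.+1) n = M n.
Proof.
elim: n M => [|n IHn] M;
  rewrite fps_comp_split ?fpsXM_coef0 // !mulrDl fpsD -mulrA fpsCM.
  by rewrite fps_residue_deriv mulr1 -!mulrA fpsXM_coef0 addr0.
have -> : g * (fps_shift M \oF g) * fps_deriv g * b ^+ n.+2 =
    fpsX * ((fps_shift M \oF g) * fps_deriv g * b ^+ n.+1).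
  by rewrite [b ^+ n.+2]exprS -[RHS]mul1r -ab1; ring.
by rewrite fps_residue_deriv mulr0 add0r fpsXM_coefS IHn.
Qed.

Lemma fps_residue_eq0 f : (forall n, (f * b ^+ n.+1) n = 0) -> f = 0.
Proof.
move=> fb0; apply/funext => n; elim/ltn_ind: n => n IHn.
have fn_b0 : f n * b 0%N ^+ n.+1 = 0.
  rewrite -(fb0 n) fpsM big_ord_recr big1 /= => [|i _].
    by rewrite add0r subnn fpsXn_coef0.
  by rewrite IHn ?mul0r.
have ab0 : b 0%N * a 0%N = 1 by rewrite mulrC -fpsM_coef0 ab1.
by rewrite -[f n]mulr1 -(expr1n _ n.+1) -ab0 exprMn mulrA fn_b0 mul0r.
Qed.

Lemma lagrange_inversion f M :
    f 0%N = M 0%N ->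
    (forall n, M n.+1 *+ n.+1 = (fps_deriv f * b ^+ n.+1) n) ->
  M \oF g = f.
Proof.
move=> fM0 M_coef; have g0 : g 0%N = 0 := fpsXM_coef0 a.
apply: (fps_deriv_inj charC0); first by rewrite fps_comp_coef0.
apply: subr0_eq; apply: fps_residue_eq0 => n.
by rewrite mulrBl fpsB -M_coef fps_deriv_comp // fps_residue_comp subrr.
Qed.

Lemma lagrange_burmann k G n : k \oF g = a ->
  (fps_deriv G * k ^+ n.+1) n = (G \oF g) n.+1 *+ n.+1.
Proof.
move=> kg; have g0 : g 0%N = 0 := fpsXM_coef0 a.
rewrite -[LHS]fps_residue_comp fps_compM // fps_compXn // kg.
have -> : (fps_deriv G \oF g) * a ^+ n.+1 * fps_deriv g * b ^+ n.+1 =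
    (fps_deriv G \oF g) * fps_deriv g * (a * b) ^+ n.+1.
  by rewrite exprMn; ring.
by rewrite ab1 expr1n mulr1 -fps_deriv_comp.
Qed.

End Lagrange.

(** * Evaluation of umbral polynomials *)

Section MonomialPowers.
Context {I : choiceType}.
Implicit Types m : {cmonom I}.

Lemma expcmnS m n : expcmn m n.+1 = mmul m (expcmn m n).
Proof. by rewrite /expcmn !(Monoid.iteropE (@mmul _)). Qed.

Lemma expcmnE m n i : expcmn m n i = (n * m i)%N.
Proof.
by elim: n => [|n IHn]; rewrite ?cm1 // expcmnS cmM IHn mulSn.
Qed.

Lemma finsupp_expcmn m n : (finsupp (expcmn m n) `<=` finsupp m)%fset.
Proof.
apply/fsubsetP => i; rewrite -!cmE_neq0 expcmnE.
by apply: contraNneq => ->; rewrite muln0.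
Qed.

End MonomialPowers.

(* Unlocked, the comparison of two monomials unfolds the finitely supported
   functions that encode them, and unification diverges. *)
HB.lock Definition umonomial {C : fieldType} {A : comAlgType C}
  (m : {cmonom (symbol A)}) : {malg A[{cmonom (symbol A)}]} := << m >>.

Section Evaluation.
Context {C : fieldType} {A : comAlgType C}.
Local Notation upoly := {malg A[{cmonom (symbol A)}]}.
Implicit Types (u v : symbol A) (m : {cmonom (symbol A)}) (p q r : upoly).

Lemma umonomial1 : umonomial mone = 1 :> upoly.
Proof. by rewrite umonomial.unlock. Qed.

Lemma umonomialM m m' :
  umonomial m * umonomial m' = umonomial (mmul m m').
Proof. by rewrite !umonomial.unlock malgM_def fgmulUU mulr1. Qed.

Lemma umonomialX m n : umonomial m ^+ n = umonomial (expcmn m n).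
Proof.
elim: n => [|n IHn]; first by rewrite umonomial1.
by rewrite exprS IHn umonomialM expcmnS.
Qed.

Lemma umE u : um u = umonomial (ucm u).
Proof. by rewrite umonomial.unlock. Qed.

Definition monomial_moment m : A := \prod_(u <- finsupp m) moment u (m u).

Lemma E_mmap p : E p = monalg.mmap idfun monomial_moment p.
Proof. by []. Qed.

Fact E_is_linear : linear_for *%R (@E C A).
Proof.
move=> c p q; rewrite !E_mmap raddfD /=; congr (_ + _).
rewrite (monalg.mmapEw (monalg.msuppZ_le _ _)) monalg.mmapE mulr_sumr.
by apply: eq_bigr => m _; rewrite monalg.mcoeffZ mulrA.
Qed.

HB.instance Definition _ := GRing.isLinear.Build A upoly A *%R (@E C A)
  E_is_linear.

Lemma series_of0 u : series_of u 0%N = 1.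
Proof.
elim: u => [[f /= /eqP]|? _ ? _ [f /= /eqP]|c v _|v IHv w _|v _] //=.
- by rewrite /fps_pow fps_comp_coef0 /exp_series fact0 invr1 scale1r.
- by rewrite fps_comp_coef0.
Qed.

Lemma moment0 u : moment u 0 = 1.
Proof. by rewrite /moment series_of0 fact0. Qed.

Lemma monomial_momentEw m (d : {fset symbol A}) : (finsupp m `<=` d)%fset ->
  monomial_moment m = \prod_(u <- d) moment u (m u).
Proof.
move=> md; apply: big_fset_incl => // u _.
by rewrite -cmE_eq0 => /eqP ->; rewrite moment0.
Qed.

Lemma E_umonomial m : E (umonomial m) = monomial_moment m.
Proof. by rewrite E_mmap umonomial.unlock monalg.mmapU mul1r. Qed.

Lemma E_umonomialM m m' : [disjoint finsupp m & finsupp m']%fset ->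
  E (umonomial m * umonomial m') = E (umonomial m) * E (umonomial m').
Proof.
move=> /fdisjointP disj; rewrite umonomialM !E_umonomial.
pose d := (finsupp m `|` finsupp m')%fset.
rewrite (@monomial_momentEw _ d) ?mdomD //.
rewrite (@monomial_momentEw m d) ?fsubsetUl //.
rewrite (@monomial_momentEw m' d) ?fsubsetUr // -big_split.
apply: eq_bigr => u _ /=; rewrite cmM.
have [/disj|] := boolP (u \in finsupp m); rewrite -cmE_eq0 => /eqP ->.
  by rewrite addn0 moment0 mulr1.
by rewrite moment0 mul1r.
Qed.

Lemma E1 : E (1 : upoly) = 1.
Proof.
by rewrite -umonomial1 E_umonomial /monomial_moment mdom1 big_seq_fset0.
Qed.

Lemma E_const (c : A) : E (uconst c) = c.
Proof. by rewrite linearZ /= E1 mulr1. Qed.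

Lemma uconstX (c : A) n : uconst c ^+ n = uconst (c ^+ n).
Proof. by rewrite /uconst exprZn expr1n. Qed.

Lemma E_uconstM (c : A) p : E (uconst c * p) = c * E p.
Proof. by rewrite -scalerAl mul1r linearZ. Qed.

Lemma E_addX_const_mul (c : A) p r n :
  E ((uconst c + p) ^+ n * r) =
  \sum_(i < n.+1) c ^+ i * E (p ^+ (n - i) * r) *+ 'C(n, i).
Proof.
rewrite addrC exprDn mulr_suml raddf_sum; apply: eq_bigr => i _ /=.
rewrite uconstX [_ * uconst _]mulrC mulrnAl -mulrA raddfMn; congr (_ *+ _).
exact: E_uconstM.
Qed.

End Evaluation.

(** * Generating series of umbral polynomials *)

Section GeneratingSeries.
Context {C : fieldType} {A : comAlgType C}.
Hypothesis charC0 : has_pchar0 C.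
Local Notation upoly := {malg A[{cmonom (symbol A)}]}.
Implicit Types (u v : symbol A) (c : A) (p q r : upoly) (F G : fps A).

Definition upoly_moment p n : A := E (p ^+ n).

Definition uncorrelated p q :=
  forall i j, E (p ^+ i * q ^+ j) = upoly_moment p i * upoly_moment q j.

(* The series [f_p(z) = E[e^(pz)]]. *)
Definition egf p : fps A := fun n => n`!%:R^-1 *: upoly_moment p n.

Lemma upoly_moment_um u n : upoly_moment (um u) n = moment u n.
Proof.
rewrite /upoly_moment umE umonomialX E_umonomial.
rewrite (@monomial_momentEw _ _ _ [fset u]%fset).
  by rewrite big_seq_fset1 expcmnE cmUU muln1.
by rewrite (fsubset_trans (finsupp_expcmn _ _)) // mdomU.
Qed.

Lemma upoly_moment_const c n : upoly_moment (uconst c) n = c ^+ n.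
Proof. by rewrite /upoly_moment uconstX E_const. Qed.

Lemma upoly_moment_constD c p n :
  upoly_moment (uconst c + p) n =
  \sum_(i < n.+1) c ^+ i * upoly_moment p (n - i) *+ 'C(n, i).
Proof.
rewrite /upoly_moment -[_ ^+ n]mulr1 E_addX_const_mul.
by apply: eq_bigr => i _; rewrite mulr1.
Qed.

Lemma uncorrelated_um u v : u != v -> uncorrelated (um u) (um v).
Proof.
move=> uv i j; rewrite /upoly_moment !umE !umonomialX; apply: E_umonomialM.
apply: (fdisjointWl (finsupp_expcmn _ _)).
apply: (fdisjointWr (finsupp_expcmn _ _)).
by rewrite !mdomU fdisjoint1X inE.
Qed.

Lemma uncorrelated_const c p : uncorrelated (uconst c) p.
Proof. by move=> i j; rewrite uconstX E_uconstM upoly_moment_const. Qed.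

Lemma uncorrelated_constD c p q :
  uncorrelated p q -> uncorrelated (uconst c + p) q.
Proof.
move=> pq i j; rewrite E_addX_const_mul upoly_moment_constD mulr_suml.
by apply: eq_bigr => l _; rewrite pq mulrnAl mulrA.
Qed.

Lemma egf_fact p n : egf p n *+ n`! = upoly_moment p n.
Proof. exact: scale_invfactK. Qed.

Lemma egf_um u : egf (um u) = series_of u.
Proof.
apply/funext => n; apply: (mulrn_fact_inj charC0 (n := n)).
by rewrite egf_fact upoly_moment_um.
Qed.

Lemma egf_const c : egf (uconst c) = exp_series c.
Proof. by apply/funext => n; rewrite /egf upoly_moment_const. Qed.

Lemma E_mul_addX r p q F G n :
    (forall i j, E (r * p ^+ i * q ^+ j) = (F i *+ i`!) * (G j *+ j`!)) ->
  E (r * (p + q) ^+ n) = (F * G) n *+ n`!.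
Proof.
move=> rpq; rewrite addrC exprDn mulr_sumr raddf_sum fpsM -sumrMnl /=.
apply: eq_bigr => -[l] /=; rewrite ltnS => le_ln _.
rewrite mulrnAr raddfMn /= [q ^+ _ * _]mulrC mulrA rpq.
exact: mulrn_fact_bin.
Qed.

Lemma egfD p q : uncorrelated p q -> egf (p + q) = egf p * egf q.
Proof.
move=> pq; apply/funext => n; apply: (mulrn_fact_inj charC0 (n := n)).
rewrite egf_fact /upoly_moment -[_ ^+ n]mul1r; apply: E_mul_addX => i j.
by rewrite mul1r pq !egf_fact.
Qed.

Lemma E_mul_addX_uncorrelated p q n : uncorrelated p q ->
  E (p * (p + q) ^+ n) = (fps_deriv (egf p) * egf q) n *+ n`!.
Proof.
move=> pq; apply: E_mul_addX => i j.
by rewrite -exprS pq /fps_deriv -mulrnA -factS !egf_fact.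
Qed.

Lemma egf_umD u v : u != v ->
  egf (um u + um v) = (series_of u : fps A) * series_of v.
Proof.
move=> uv; rewrite -(egf_um u) -(egf_um v).
exact/egfD/uncorrelated_um.
Qed.

Lemma egf_const_umD c u :
  egf (uconst c + um u) = (exp_series c : fps A) * series_of u.
Proof.
rewrite -egf_const -egf_um.
exact/egfD/uncorrelated_const.
Qed.

Lemma E_mul_addX_um u v n : u != v ->
  E (um u * (um u + um v) ^+ n) =
  (fps_deriv (series_of u) * (series_of v : fps A)) n *+ n`!.
Proof.
move=> uv; rewrite -(egf_um u) -(egf_um v).
exact/E_mul_addX_uncorrelated/uncorrelated_um.
Qed.

Lemma E_mul_addX_const_um c u v n : u != v ->
  E ((uconst c + um u) * (uconst c + um u + um v) ^+ n) =
  (fps_deriv ((exp_series c : fps A) * series_of u) *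
     (series_of v : fps A)) n *+ n`!.
Proof.
move=> uv; rewrite -egf_const_umD -(egf_um v).
exact/E_mul_addX_uncorrelated/uncorrelated_constD/uncorrelated_um.
Qed.

End GeneratingSeries.

(** * Sheffer sequences and Abel umbrae *)

Section Sheffer.
Context {C : fieldType} {A : comAlgType C}.
Hypothesis charC0 : has_pchar0 C.
Implicit Types (alpha : symbol A) (gamma : umbra A) (x : A).
Local Notation ser u := (series_of u : fps A).

Lemma series_of_bell_deriv alpha x :
  series_of (ScalDot x (Defs.Dot (bell_umbra A) (Deriv alpha))) =
  exp_series x \oF (fpsX * ser alpha).
Proof.
rewrite /= -/(series_of (Deriv alpha)) fps_pow_bell_log ?series_of0 //.
congr (_ \oF _); apply/funext => -[|n]; rewrite /fps_sub1 /=.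
  by rewrite fpsXM_coef0 subrr.
by rewrite fpsXM_coefS subr0.
Qed.

Lemma sheffer_series alpha gamma x n :
  sheffer gamma alpha x n =
  (ser gamma * (exp_series x \oF (fpsX * ser alpha))) n *+ n`!.
Proof.
rewrite /sheffer -/(upoly_moment _ n) -egf_fact // egf_umD //; last exact/eqP.
by rewrite series_of_bell_deriv.
Qed.

Lemma abel_umbra_comp alpha gamma :
  series_of (abel_umbra gamma alpha) \oF (fpsX * ser alpha) = ser gamma.
Proof.
have alpha_inv := fps_mul_powN1 charC0 (series_of0 alpha).
apply: (lagrange_inversion charC0 alpha_inv) => [|n].
  by rewrite !series_of0.
apply: (mulrn_fact_inj charC0 (n := n)).
rewrite -mulrnA -factS /= scale_invfactK //.
rewrite E_mul_addX_um //; last exact/eqP.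
by rewrite -mulNrn /= fps_powMn.
Qed.

Lemma sheffer_abel (alpha gamma : umbra A) x n :
  sheffer gamma alpha x n.+1 =
  E ((uconst x + um (abel_umbra gamma alpha)) *
     (uconst x + um (abel_umbra gamma alpha)
        + um (ScalDot n.+1%:R (abel_umbra alpha alpha))) ^+ n).
Proof.
have alpha_inv := fps_mul_powN1 charC0 (series_of0 alpha).
rewrite E_mul_addX_const_um //; last exact/eqP.
rewrite [series_of (ScalDot _ _)]fps_pow_nat ?(series_of0 (abel_umbra _ _)) //.
rewrite (lagrange_burmann charC0 alpha_inv _ _ (abel_umbra_comp _ _)).
rewrite -mulrnA -factS fps_compM ?fpsXM_coef0 // abel_umbra_comp mulrC.
exact: sheffer_series.
Qed.

End Sheffer.

Theorem mainTheorem5 (R : realType) (k : nat) (j : 'I_k)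
    (alpha gamma : umbra (mpoly k R[i]))
    (s : nat -> mpoly k R[i]) (s_0 : s 0%N = 1) :
  let x : mpoly k R[i] := 'X_j in
  is_sheffer_sequence gamma alpha x s <->
  (forall n : nat, (1 <= n)%N ->
     umbral_equiv (uconst (s n))
       ((uconst x + um (abel_umbra gamma alpha)) *
        (uconst x + um (abel_umbra gamma alpha)
           + um (ScalDot n%:R (abel_umbra alpha alpha))) ^+ n.-1)).
Proof.
have char0 := @pchar_num R[i].
move=> x; rewrite /umbral_equiv.
split=> [s_sheffer [/notF[]|n _] | s_abel [|n]].
- by rewrite [LHS]E_const s_sheffer (sheffer_abel char0).
- by rewrite s_0 /sheffer expr0 E1.
- by rewrite (sheffer_abel char0) -[RHS](s_abel n.+1 isT) [RHS]E_const.
Qed.
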